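(* Let $n$ be a positive integer with $n\equiv0\pmod 3$. Then $P(n,2n/3)=n+2$.
   Context: A binary sequence $s=s_0\cdots s_{N-1}$ is an $(n,d)$-robust positioning sequence if for all $0\le i<j\le N-n$ the Hamming distance between $s_i\cdots s_{i+n-1}$ and $s_j\cdots s_{j+n-1}$ is at least $d$. $P(n,d)$ denotes the maximum length $N$ of a binary $(n,d)$-robust positioning sequence. *)

(* Defs.v *)
From mathcomp Require Import all_boot.

Set Implicit Arguments.
Unset Strict Implicit.
Unset Printing Implicit Defensive.

Definition window (s : seq bool) (n i : nat) : seq bool := take n (drop i s).

(* Only meaningful for words of equal size: zip truncates. *)
Definition hamming (u v : seq bool) : nat :=
  count (fun p => p.1 != p.2) (zip u v).

(* j + n <= size s is j <= size s - n over the integers; unlike truncated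
   subtraction, it gives no windows at all when size s < n. *)
Definition robust_positioning (n d : nat) (s : seq bool) : Prop :=
  forall i j : nat, i < j -> j + n <= size s ->
    d <= hamming (window s n i) (window s n j).

(* P(n, d) = N. Stated as a relation, since the maximum need not exist
   for d = 0. *)
Definition max_robust_length (n d N : nat) : Prop :=
  (exists2 s : seq bool, size s = N & robust_positioning n d s) /\
  (forall s : seq bool, robust_positioning n d s -> size s <= N).

(* Main.v *)
(** Upper bound: if [size s >= n + 3], compare the four windows at 0, 1, 2, 3.
    A column of four bits separates at most 4 of the 6 pairs of windows, while
    the six distances sum to at least 6 * (2n/3) = 4n; so every column
    [s_k s_(k+1) s_(k+2) s_(k+3)] contains exactly two ones.  Then
    [s_k <> s_(k+2)] iff [s_(k+1) <> s_(k+3)], so the windows 0 and 2 are either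
    equal, which is absurd, or complementary.  In the latter case so are the
    windows 1 and 3, and the other four distances sum to 2n < 4 * (2n/3).

    Lower bound: the word 010010010... of period 3 attains length [n + 2]. *)

Require Import Defs.
From mathcomp Require Import all_boot zify.

Lemma window_mkseq (s : seq bool) (n i : nat) : i + n <= size s ->
  window s n i = mkseq (fun k => nth false s (i + k)) n.
Proof.
move=> le_in.
have size_w : size (window s n i) = n by rewrite size_takel ?size_drop //; lia.
apply: (@eq_from_nth _ false) => [|k]; rewrite size_w ?size_mkseq // => lt_kn.
by rewrite nth_mkseq // nth_take // nth_drop.
Qed.

Lemma hamming_window (s : seq bool) (n i j : nat) :
  i + n <= size s -> j + n <= size s ->
  hamming (window s n i) (window s n j) =
  \sum_(k < n) (nth false s (i + k) != nth false s (j + k)).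
Proof.
move=> le_in le_jn; rewrite /hamming !window_mkseq // /mkseq zip_map count_map.
rewrite -sum1_count big_mkcond -[n in LHS]subn0 -/(index_iota 0 n) big_mkord.
by apply: eq_bigr => k _ /=; case: (_ != _).
Qed.

Lemma robust_four_windows (n d : nat) (s : seq bool) :
  3 %| n -> 0 < n -> d = (2 * n) %/ 3 -> robust_positioning n d s ->
  size s <= n + 2.
Proof.
move=> n3 n_gt0 d_def rob; rewrite leqNgt; apply/negP => lt_size.
have d3 : 3 * d = 2 * n by lia.
pose x := nth false s; pose h i j := \sum_(k < n) (x (i + k) != x (j + k)).
have le_dh i j : i < j -> j <= 3 -> d <= h i j.
  by move=> lt_ij le_j3; rewrite /h -hamming_window; [apply: rob|..]; lia.
(* [c k] counts the pairs of windows that differ in column [k]: it is 0, 3 or 4 as the four bits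
   split 4+0, 3+1 or 2+2. *)
pose c k := (x (0 + k) != x (1 + k)) + (x (0 + k) != x (2 + k))
  + (x (0 + k) != x (3 + k)) + (x (1 + k) != x (2 + k))
  + (x (1 + k) != x (3 + k)) + (x (2 + k) != x (3 + k)).
have sum_c : \sum_(k < n) c k = h 0 1 + h 0 2 + h 0 3 + h 1 2 + h 1 3 + h 2 3.
  by rewrite /c !big_split.
have h01 := le_dh 0 1 isT isT; have h02 := le_dh 0 2 isT isT.
have h03 := le_dh 0 3 isT isT; have h12 := le_dh 1 2 isT isT.
have h13 := le_dh 1 3 isT isT; have h23 := le_dh 2 3 isT isT.
have c_le4 k : c k <= 4.
  by rewrite /c; case: (x (0 + k)) (x (1 + k)) (x (2 + k)) (x (3 + k))
    => [] [] [] [].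
(* The equality case is what matters: the six bounds [d <= h i j] push the sum up to [n * 4], so
   each column attains 4. *)
have [le_c4 eq_c4] : \sum_(k < n) c k <= \sum_(k < n) 4
    ?= iff [forall k : 'I_n, c k == 4].
  by apply: leqif_sum => k _; apply/leqif_eq.
rewrite sum_nat_const card_ord in le_c4 eq_c4.
have balanced k : k < n -> c k = 4.
  move=> lt_kn; have: \sum_(k < n) c k == n * 4 by apply/eqP; lia.
  by rewrite eq_c4 => /forallP/(_ (Ordinal lt_kn))/eqP.
have alt k : k < n -> (x k != x (2 + k)) = (x (1 + k) != x (3 + k)).
  move/balanced; rewrite /c add0n.
  by case: (x k) (x (1 + k)) (x (2 + k)) (x (3 + k)) => [] [] [] [].
(* By [alt], the comparison of bits two apart has the same outcome at [k] and at [k + 1]. *)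
have alt_const k : k <= n -> (x k != x (2 + k)) = (x 0 != x 2).
  elim: k => [|k IHk] lt_kn; first by [].
  by rewrite -IHk 1?ltnW // (alt k).
have h02E : h 0 2 = n * (x 0 != x 2).
  rewrite /h -[in RHS](card_ord n) -sum_nat_const.
  by apply: eq_bigr => k _; rewrite add0n alt_const // ltnW.
have h13E : h 1 3 = n * (x 0 != x 2).
  rewrite /h -[in RHS](card_ord n) -sum_nat_const.
  by apply: eq_bigr => k _; rewrite -alt // alt_const // ltnW.
by case: (x 0 != x 2) h02E h13E; lia.
Qed.

Lemma sum_period3 (f : nat -> nat) (m : nat) : (forall k, f (k + 3) = f k) ->
  \sum_(k < m * 3) f k = m * (f 0 + f 1 + f 2).
Proof.
move=> f_per; have f_mul q r : f (q * 3 + r) = f r.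
  elim: q => [|q IHq]; first by [].
  by rewrite -IHq -[RHS]f_per; congr f; lia.
elim: m => [|m IHm]; first by rewrite big_ord0.
rewrite mulSn addnC !addnS addn0 !big_ord_recr /= IHm.
by rewrite -[m * 3]addn0 -!addnS !f_mul; lia.
Qed.

(** A shift of the pattern 010 by 1 or 2 moves its only one within each period, so two such windows
    disagree at exactly two places of each of the [m] periods. *)
Lemma robust_period3 (m : nat) :
  robust_positioning (m * 3) (2 * m) (mkseq (fun k => k %% 3 == 1) (m * 3 + 2)).
Proof.
move=> i j lt_ij; rewrite size_mkseq => le_j.
rewrite hamming_window ?size_mkseq; try lia.
rewrite (eq_bigr (fun k : 'I__ => ((i + k) %% 3 == 1) != ((j + k) %% 3 == 1)
  : nat)); last by move=> k _; rewrite !nth_mkseq //; have := ltn_ord k; lia.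
rewrite (@sum_period3 (fun k => ((i + k) %% 3 == 1) != ((j + k) %% 3 == 1)));
  last by move=> k; rewrite !addnA !modnDr.
(* The length leaves room only for windows starting at 0, 1 and 2. *)
have [[-> ->]|[[-> ->]|[-> ->]]] : (i = 0 /\ j = 1) \/
  (i = 0 /\ j = 2) \/ (i = 1 /\ j = 2) by lia.
all: by rewrite mulnC.
Qed.

Theorem theorem7p3 (n : nat) (n_gt0 : 0 < n) (n_mod3 : n = 0 %[mod 3]) :
  max_robust_length n ((2 * n) %/ 3) (n + 2).
Proof.
have n3 : 3 %| n by rewrite /dvdn n_mod3.
split=> [|s]; last exact: robust_four_windows.
case/dvdnP: n3 => m ->; rewrite mulnA mulnK //.
by exists (mkseq (fun k => k %% 3 == 1) (m * 3 + 2));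
  [rewrite size_mkseq | apply: robust_period3].
Qed.
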